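(* Consider the following randomized procedure with input: a ground set $V$ of $n$ elements, a nonnegative submodular $f$ on $V$ (value oracle), weights $w:V\to\{0,1\}$, a number $W>0$, a target $B>0$, and $p\in(0,1)$. Let $c=1/(4\sqrt{2\pi})$ and $U_0=\emptyset$, $i=0$. Case $W\ge w(V)/2$: while $w(U_i)<W/2$, let $T_i$ minimize $f(T)-\frac{2B}{W}w(T\setminus U_i)$ over $T\subseteq V$; if $f(T_i)<\frac{2B}{W}w(T_i\setminus U_i)$ set $U_{i+1}=U_i\cup T_i$, $i\leftarrow i+1$, else return ''fail''; when the loop ends return $U=U_i$. Case $W<w(V)/2$: let $\alpha=\frac{2B}{W}\sqrt{\frac{n}{\ln n}}$; while $w(U_i)<W/2$: choose a random $S_i\subseteq V\setminus U_i$ including each element independently with probability $W/w(V)$; let $T_i$ minimize $f(T)-\alpha\,w(T\cap S_i)$ over $T\subseteq V$; if $f(T_i)\le\alpha\,w(T_i\cap S_i)$ and $f(T_i)\le 4B\sqrt{n/\ln n}$, set $U_{i+1}=U_i\cup T_i$, $i\leftarrow i+1$; if the number of loop iterations exceeds $\frac{3n^{9/2}}{c}\ln\frac{n}{1-p}$, return ''fail''. When the loop ends return $U=U_i$. Then this procedure is a $\left(5\sqrt{\frac{n}{\ln n}},\frac12\right)$ bicriteria decision procedure: given a feasible instance, it outputs a set $U$ with $f(U)\le 5\sqrt{\frac{n}{\ln n}}\,B$ and $w(U)\ge W/2$ with probability at least $p$.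
   Context: $f:2^V\to\mathbb{R}_{\ge0}$ is submodular if $f(S)+f(T)\ge f(S\cup T)+f(S\cap T)$ for all $S,T\subseteq V$. For $S\subseteq V$, $w(S)=\sum_{v\in S}w(v)$. The problem (Submodular Minimization with Cardinality Lower Bound, 0-1 weighted version) is to find $S$ with $w(S)\ge W$ minimizing $f(S)$. An instance with target $B$ is feasible if there exists $U^*\subseteq V$ with $w(U^* )\ge W$ and $f(U^* )<B$. All minimizations are exact submodular function minimizations.
   Formalization: Proved for n ≥ 2 (so that n/ln n is defined) and, in the case W < w(V)/2, for W ≥ 1; for W near 0 the claim fails, since the inclusion probability W/w(V) tends to 0 while the iteration limit does not depend on W (e.g. f constant with 0 < f < B). *)

(* Defs.v *)
From HB Require Import structures.
From mathcomp Require Import all_boot all_order all_algebra.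
From mathcomp Require Import all_classical all_reals all_analysis.

Set Implicit Arguments.
Unset Strict Implicit.
Unset Printing Implicit Defensive.

Import Order.TTheory GRing.Theory Num.Theory.
Import numFieldNormedType.Exports.

Local Open Scope ring_scope.

Definition submodular (R : realType) (V : finType) (f : {set V} -> R) : Prop :=
  forall S T : {set V}, f (S :|: T) + f (S :&: T) <= f S + f T.

(* {0,1}-valued weights are booleans, read as numbers through bool >-> nat. *)
Definition weight (R : realType) (V : finType) (w : V -> bool) (S : {set V}) : R :=
  \sum_(v in S) (w v)%:R.

Definition feasible (R : realType) (V : finType) (f : {set V} -> R)
    (w : V -> bool) (W B : R) : Prop :=
  exists U : {set V}, W <= weight R w U /\ f U < B.

(* A call to the minimization oracle receives the list of the objectives of the
   earlier calls and the current objective: ties between minimizers may be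
   broken differently from one iteration to the next. *)
Definition sfm_oracle (R : realType) (V : finType) : Type :=
  seq ({set V} -> R) -> ({set V} -> R) -> {set V}.

Definition exact_sfm (R : realType) (V : finType) (sfm : sfm_oracle R V) : Prop :=
  forall (h : seq ({set V} -> R)) (g : {set V} -> R),
    submodular g -> forall T : {set V}, g (sfm h g) <= g T.

(* Randomized programs denote probability mass functions on finite types. *)
Definition dist (R : realType) (T : finType) : Type := T -> R.

Definition dret (R : realType) (T : finType) (x : T) : dist R T :=
  fun y => (y == x)%:R.

Definition dbind (R : realType) (T T' : finType)
    (d : dist R T) (k : T -> dist R T') : dist R T' :=
  fun y => \sum_(x : T) d x * k x y.

Definition prob (R : realType) (T : finType) (d : dist R T) (E : pred T) : R :=
  \sum_(x | E x) d x.

Definition random_subset (R : realType) (V : finType) (A : {set V}) (q : R) :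
    dist R {set V} :=
  fun S => if S \subset A
           then \prod_(v in A) (if v \in S then q else 1 - q) else 0.

Definition sqrt_n_over_ln (R : realType) (V : finType) : R :=
  Num.sqrt (#|V|%:R / ln #|V|%:R).

Definition iteration_bound (R : realType) (V : finType) (p : R) : R :=
  let n : R := #|V|%:R in
  let c : R := 1 / (4 * Num.sqrt (2 * pi)) in
  3 * n `^ (9 / 2) / c * ln (n / (1 - p)).

(* The two loops are unrolled at most [fuel] times.  The result is [Some U] when
   U has been returned, and [None] after "fail" or when the fuel has run out. *)
Fixpoint large_loop (R : realType) (V : finType) (sfm : sfm_oracle R V)
    (f : {set V} -> R) (w : V -> bool) (W B : R)
    (fuel : nat) (h : seq ({set V} -> R)) (U : {set V}) : option {set V} :=
  if fuel is fuel'.+1 then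
    if weight R w U < W / 2 then
      let g := fun T : {set V} => f T - 2 * B / W * weight R w (T :\: U) in
      let T := sfm h g in
      if f T < 2 * B / W * weight R w (T :\: U)
      then large_loop sfm f w W B fuel' (rcons h g) (U :|: T)
      else None
    else Some U
  else None.

(* [k] is the number of iterations performed so far. *)
Fixpoint small_loop (R : realType) (V : finType) (sfm : sfm_oracle R V)
    (f : {set V} -> R) (w : V -> bool) (W B p : R)
    (fuel k : nat) (h : seq ({set V} -> R)) (U : {set V}) :
    dist R (option {set V}) :=
  if fuel is fuel'.+1 then
    if weight R w U < W / 2 then
      let alpha := 2 * B / W * sqrt_n_over_ln R V in
      dbind (random_subset (~: U) (W / weight R w [set: V])) (fun S =>
        let g := fun T : {set V} => f T - alpha * weight R w (T :&: S) in
        let T := sfm h g in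
        let U' := if (f T <= alpha * weight R w (T :&: S))
                       && (f T <= 4 * B * sqrt_n_over_ln R V)
                  then U :|: T else U in
        if iteration_bound V p < k.+1%:R then dret R None
        else small_loop sfm f w W B p fuel' k.+1 (rcons h g) U')
    else dret R (Some U)
  else dret R None.

Definition procedure (R : realType) (V : finType) (sfm : sfm_oracle R V)
    (f : {set V} -> R) (w : V -> bool) (W B p : R) (fuel : nat) :
    dist R (option {set V}) :=
  if weight R w [set: V] / 2 <= W
  then dret R (large_loop sfm f w W B fuel [::] finset.set0)
  else small_loop sfm f w W B p fuel 0 [::] finset.set0.

Definition bicriteria_solution (R : realType) (V : finType)
    (f : {set V} -> R) (w : V -> bool) (W B sigma rho : R) :
    pred (option {set V}) :=
  fun o => if o is Some U then (f U <= sigma * B) && (rho * W <= weight R w U)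
           else false.

Lemma dret_sum1 (R : realType) (T : finType) (x : T) : \sum_y dret R x y = 1.
Proof.
by rewrite (bigD1 x) //= big1 ?addr0 /dret ?eqxx // => y /negPf ->.
Qed.

Lemma random_subset_ge0 (R : realType) (V : finType) (A : {set V}) (q : R)
  (S : {set V}) : 0 <= q -> q <= 1 -> 0 <= random_subset A q S.
Proof.
move=> q0 q1; rewrite /random_subset; case: ifP => // _.
by apply: prodr_ge0 => v _; case: ifP; rewrite // subr_ge0.
Qed.

Lemma random_subset_sum1 (R : realType) (V : finType) (A : {set V}) (q : R) :
  \sum_S random_subset A q S = 1.
Proof.
transitivity (\prod_(v : V)
    ((if v \in A then q else 0) + (if v \in A then 1 - q else 1))); last first.
  by rewrite big1 // => v _; case: ifP; rewrite ?add0r // addrC subrK.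
rewrite bigA_distr; apply: eq_bigr => S _; rewrite /random_subset.
case: ifPn => [sSA|/subsetPn[v vS vA]].
  rewrite big_mkcond; apply: eq_bigr => v _ /=.
  have [vS|vS] := boolP (v \in S); last by [].
  by rewrite (fintype.subsetP sSA _ vS).
by rewrite (bigD1 v) //= vS (negPf vA) mul0r.
Qed.

Lemma procedure_sum1 (R : realType) (V : finType) (sfm : sfm_oracle R V)
    (f : {set V} -> R) (w : V -> bool) (W B p : R) (fuel : nat) :
  \sum_o procedure sfm f w W B p fuel o = 1.
Proof.
rewrite /procedure; case: ifP => _; first exact: dret_sum1.
move: (0%N) (Nil ({set V} -> R)) (finset.set0 : {set V}).
elim: fuel => [|fuel IH] k h U /=; first exact: dret_sum1.
case: ifP => _; last exact: dret_sum1.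
rewrite /dbind exchange_big /= -[RHS](random_subset_sum1 (~: U) (W / weight R w [set: V])).
apply: eq_bigr => S _; rewrite -mulr_sumr.
by case: (iteration_bound _ _ < _); rewrite ?dret_sum1 ?IH mulr1.
Qed.

(* Main.v *)
Require Import Defs.
From HB Require Import structures.
From mathcomp Require Import all_boot all_order all_algebra.
From mathcomp Require Import all_classical all_reals all_analysis.
From mathcomp Require Import ring lra zify.

(** Write [s = sqrt (n / ln n)] and [alpha = 2 B s / W].  Every accepted set is
    charged to the weight it adds, at the price [alpha] per unit: the sets
    accepted before the weight reaches [W / 2] cost at most [alpha W / 2 = B s]
    and the last one at most [4 B s].  If the sample [S] meets the feasible set
    [U*] in weight at least [W / (2 s) = B / alpha] and its complement in weight
    at most [3 W / 2], comparing the minimizer with [U*] shows that it is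
    accepted and adds weight.  The two events are independent.  The second has
    probability at least [1/3] by Markov's inequality.  The first is an upper
    tail of a binomial law with at least [W / 2] trials of probability
    [q >= W / n]: when [q >= 1 / s] the threshold is below the mean and a
    variance argument applies; when [q < 1 / s] the threshold is below
    [ln n / 2], and the probability of a single value is at least [n ^ -2].  So
    every iteration adds weight with probability at least [1 / (12 n ^ 2)], and
    the permitted number of iterations is far more than what is needed to add
    weight [n] times. *)

Import Order.TTheory GRing.Theory Num.Theory.
Import numFieldNormedType.Exports.

Local Open Scope ring_scope.


(** * Binomial expectations: moments, atoms and elementary tail bounds *)

(* The expectation of [phi X] for [X] binomially distributed with parameters
   [k] and [q], unfolded along the last Bernoulli trial. *)
Fixpoint binomial_mean (R : realType) (q : R) (k : nat) (phi : nat -> R) : R :=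
  if k is k'.+1
  then q * binomial_mean R q k' (fun i => phi i.+1) +
       (1 - q) * binomial_mean R q k' phi
  else phi 0%N.

Arguments binomial_mean {R} q k phi.

Lemma binomial_mean_le (R : realType) (q : R) (k : nat)
    (phi psi : nat -> R) : 0 <= q -> q <= 1 ->
  (forall i, (i <= k)%N -> phi i <= psi i) ->
  binomial_mean q k phi <= binomial_mean q k psi.
Proof.
move=> q0 q1; elim: k phi psi => [|k IH] phi psi le_phi; first exact: le_phi.
by rewrite /= lerD // ler_wpM2l ?subr_ge0 //; apply: IH => i ik;
  apply: le_phi => //; apply: leqW.
Qed.

Lemma binomial_mean_affine (R : realType) (q a b : R) (k : nat) (phi : nat -> R) :
  binomial_mean q k (fun i => a * phi i + b) = a * binomial_mean q k phi + b.
Proof. by elim: k phi => [|k IH] phi //=; rewrite !IH; ring. Qed.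

Lemma binomial_meanD (R : realType) (q : R) (k : nat) (phi psi : nat -> R) :
  binomial_mean q k (fun i => phi i + psi i) =
  binomial_mean q k phi + binomial_mean q k psi.
Proof. by elim: k phi psi => [|k IH] phi psi //=; rewrite !IH; ring. Qed.

Lemma binomial_meanZ (R : realType) (q a : R) (k : nat) (phi : nat -> R) :
  binomial_mean q k (fun i => a * phi i) = a * binomial_mean q k phi.
Proof. by elim: k phi => [|k IH] phi //=; rewrite !IH; ring. Qed.

(** The shift [x] is kept general because a success in the last trial turns [i.+1 - x] into
    [i - (x - 1)], so the induction changes [x]. *)
Lemma binomial_mean_id (R : realType) (q x : R) (k : nat) :
  binomial_mean q k (fun i => i%:R - x) = k%:R * q - x.
Proof.
elim: k x => [|k IH] x /=; first by rewrite mul0r.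
transitivity (q * (k%:R * q - (x - 1)) + (1 - q) * (k%:R * q - x)).
  rewrite -!IH; congr (q * _ + _); congr binomial_mean.
  by apply/funext => i; rewrite -natr1; ring.
by rewrite -natr1; ring.
Qed.

(** Squared bias plus variance; again the induction moves [x] to [x - 1]. *)
Lemma binomial_mean_sqr (R : realType) (q x : R) (k : nat) :
  binomial_mean q k (fun i => (i%:R - x) ^+ 2) =
  (k%:R * q - x) ^+ 2 + k%:R * q * (1 - q).
Proof.
elim: k x => [|k IH] x /=; first by rewrite !mul0r addr0.
transitivity (q * ((k%:R * q - (x - 1)) ^+ 2 + k%:R * q * (1 - q)) +
              (1 - q) * ((k%:R * q - x) ^+ 2 + k%:R * q * (1 - q))).
  rewrite -!IH; congr (q * _ + _); congr binomial_mean.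
  by apply/funext => i; rewrite -natr1; ring.
by rewrite -natr1; ring.
Qed.

Lemma binomial_mean_eq (R : realType) (q : R) (k j : nat) :
  binomial_mean q k (fun i => (i == j)%:R) =
  'C(k, j)%:R * q ^+ j * (1 - q) ^+ (k - j).
Proof.
elim: k j => [|k IH] [|j] /=.
- by rewrite bin0 !expr0 !mulr1.
- by rewrite bin0n !mul0r.
- rewrite IH.
  (* After a success the value 0 is out of reach. The zero function is written in affine form so
     that [binomial_mean_affine] evaluates its mean. *)
  have -> : (fun i => (i.+1 == 0)%:R) = (fun i : nat => 0 * 0 + 0 : R).
    by apply/funext => i; rewrite mul0r addr0.
  by rewrite (binomial_mean_affine R q 0 0 k (fun=> 0)) !bin0 !subn0 exprS; ring.
- rewrite [X in q * X]IH IH binS natrD subSS exprS.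
  have [jk|kj] := ltnP j k.
    by rewrite -[in LHS](subnSK jk) -[in RHS](subnSK jk) !exprS; ring.
  by rewrite [X in _ + (1 - q) * (X%:R * _ * _)]bin_small ?ltnS //
     [X in (X%:R + _)]bin_small ?ltnS //; ring.
Qed.

Lemma binomial_mean_leS (R : realType) (q : R) (k : nat) (phi : nat -> R) :
  0 <= q -> q <= 1 -> (forall i, phi i <= phi i.+1) ->
  binomial_mean q k phi <= binomial_mean q k.+1 phi.
Proof.
move=> q0 q1 phiS /=.
have : binomial_mean q k phi <= binomial_mean q k (fun i => phi i.+1).
  by apply: binomial_mean_le.
nra.
Qed.

(** Extra trials can only raise the count, so a tail may be bounded with a smaller, more convenient
    number of trials. *)
Lemma binomial_mean_homo (R : realType) (q : R) (phi : nat -> R) :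
  0 <= q -> q <= 1 -> (forall i, phi i <= phi i.+1) ->
  {homo (fun k => binomial_mean q k phi) : k l / (k <= l)%N >-> k <= l}.
Proof.
move=> q0 q1 phiS; apply: homo_leq => // [x y z|k]; first exact: le_trans.
exact: binomial_mean_leS.
Qed.

(** The binomial coefficient is the product of the ratios [(k - i) / (j - i)] for [i < j], each at
    least [k / j]. *)
Lemma bin_ge_expr_div (R : realFieldType) (k j : nat) : (j <= k)%N ->
  (k%:R / j%:R) ^+ j <= 'C(k, j)%:R :> R.
Proof.
elim: j k => [|j IH] [|k] // jk; rewrite ?expr0 ?bin0 //.
have -> : 'C(k.+1, j.+1)%:R = k.+1%:R / j.+1%:R * 'C(k, j)%:R :> R.
  apply: (mulfI (_ : j.+1%:R != 0)); first by rewrite pnatr_eq0.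
  by rewrite -natrM -mul_bin_diag natrM; field; rewrite addrC natr1 pnatr_eq0.
rewrite exprS ler_wpM2l ?divr_ge0 //; apply: le_trans (IH k jk).
case: j jk {IH} => [|j] jk; first by rewrite !expr0.
rewrite lerXn2r ?nnegrE ?divr_ge0 //.
rewrite ler_pdivrMr // mulrAC ler_pdivlMr // -!natrM ler_nat; nia.
Qed.

(* For [|y| <= k] the indicator of [0 <= y] dominates [(y^2 + k y) / (2 k^2)];
   at [y = X - k q] the linear term has mean 0, which leaves the variance. *)
Lemma binomial_tail_ge_mean (R : realType) (q : R) (k : nat) :
  (0 < k)%N -> 0 <= q -> q <= 1 ->
  q * (1 - q) / (2 * k%:R) <=
  binomial_mean q k (fun i => (k%:R * q <= i%:R)%R%:R).
Proof.
move=> k0 q0 q1; have kp : 0 < k%:R :> R by rewrite ltr0n.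
pose phi i : R := i%:R - k%:R * q.
have -> : q * (1 - q) / (2 * k%:R) =
    binomial_mean q k (fun i => (2 * k%:R ^+ 2)^-1 * ((phi i) ^+ 2 + k%:R * phi i)).
  rewrite binomial_meanZ (binomial_meanD R q k (fun i => phi i ^+ 2)).
  rewrite binomial_meanZ binomial_mean_sqr binomial_mean_id.
  by field; rewrite gt_eqF.
apply: binomial_mean_le => // i ik.
have ikR : i%:R <= k%:R :> R by rewrite ler_nat.
have i0 : 0 <= i%:R :> R by [].
have kq : k%:R * q <= k%:R by rewrite ler_piMr.
have kq0 : 0 <= k%:R * q by rewrite mulr_ge0.
rewrite mulrC ler_pdivrMr; last by rewrite mulr_gt0 // exprn_gt0.
rewrite /phi; move: (k%:R * q) kq kq0 => m kq kq0.
by case: (leP m i%:R) => H /=; rewrite ?mulr1n ?mulr0n; nra.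
Qed.

(** The indicator of [X <= a] dominates the affine function [1 - X / a]. *)
Lemma binomial_markov (R : realType) (q a : R) (k : nat) :
  0 <= q -> q <= 1 -> 0 < a ->
  1 - k%:R * q / a <= binomial_mean q k (fun i => (i%:R <= a)%R%:R).
Proof.
move=> q0 q1 a0.
have -> : 1 - k%:R * q / a = binomial_mean q k (fun i => - a^-1 * (i%:R - 0) + 1).
  by rewrite binomial_mean_affine binomial_mean_id; ring.
apply: binomial_mean_le => // i _; rewrite subr0.
have i0 : 0 <= i%:R / a by rewrite divr_ge0 // ltW.
rewrite mulNr mulrC; case: (leP i%:R a) => H /=; first by rewrite mulr1n; lra.
by rewrite mulr0n addrC subr_le0 ler_pdivlMr // mul1r ltW.
Qed.

(** * Counts in a random subset as independent binomial variables *)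

(** Conditioning on whether [x] is sampled; the samples containing [x] are reindexed by removing
    it. *)
Lemma random_subset_mean_setU1 (R : realType) (V : finType) (A : {set V}) (x : V)
    (q : R) (phi : {set V} -> R) : x \notin A ->
  \sum_S random_subset (x |: A) q S * phi S =
  q * (\sum_S random_subset A q S * phi (x |: S)) +
  (1 - q) * (\sum_S random_subset A q S * phi S).
Proof.
move=> xA.
have rs0 (S : {set V}) : x \in S -> random_subset A q S = 0.
  move=> xS; rewrite /random_subset ifF //; apply/negbTE/subsetPn.
  by exists x.
have sumN (psi : {set V} -> R) : \sum_S random_subset A q S * psi S =
    \sum_(S : {set V} | x \notin S) random_subset A q S * psi S.
  rewrite [RHS]big_mkcond; apply: eq_bigr => S _; case: ifP => // /negbFE xS.
  by rewrite rs0 // mul0r.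
rewrite (bigID (fun S : {set V} => x \in S)) /=; congr (_ + _).
  rewrite (reindex_onto (fun S => x |: S) (fun S => S :\ x)) /=; last first.
    by move=> S xS; rewrite finset.setD1K.
  rewrite sumN mulr_sumr; apply: eq_big => S.
    rewrite finset.setU11 /=; apply/eqP/idP => [<-|xS]; first by rewrite !inE eqxx.
    by rewrite setU1K.
  move=> /andP[_ /eqP SE].
  have xS : x \notin S by rewrite -SE !inE eqxx.
  rewrite mulrA; congr (_ * _); rewrite /random_subset.
  have -> : (x |: S \subset x |: A) = (S \subset A).
    apply/fintype.subsetP/fintype.subsetP => sSA y yS.
      have := sSA y; rewrite !inE yS orbT => /(_ isT)/orP[/eqP yx|//].
      by rewrite -yx yS in xS.
    by move: yS; rewrite !inE => /orP[->//|/sSA ->]; rewrite orbT.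
  case: ifP => _; last by rewrite mulr0.
  rewrite big_setU1 //= finset.setU11; congr (_ * _); apply: eq_bigr => y yA.
  rewrite !inE; case: eqP => // yx; by rewrite -yx yA in xA.
rewrite sumN mulr_sumr; apply: eq_bigr => S xS.
rewrite mulrA; congr (_ * _); rewrite /random_subset.
have -> : (S \subset x |: A) = (S \subset A).
  apply/fintype.subsetP/fintype.subsetP => sSA y yS.
    have := sSA y yS; rewrite !inE => /orP[/eqP yx|//].
    by rewrite -yx yS in xS.
  by rewrite !inE sSA ?orbT.
case: ifP => _; last by rewrite mulr0.
by rewrite big_setU1 //= (negbTE xS).
Qed.

(** Disjointness makes the two counts depend on different trials, hence the iterated mean. The
    induction removes one element of [A], which lies in [K], in [L] or in neither. *)
Lemma random_subset_mean_card (R : realType) (V : finType) (A K L : {set V})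
    (q : R) (phi : nat -> nat -> R) : [disjoint K & L] ->
  \sum_S random_subset A q S * phi #|S :&: K| #|S :&: L| =
  binomial_mean q #|A :&: K|
    (fun i => binomial_mean q #|A :&: L| (fun j => phi i j)).
Proof.
move=> dKL; have [n] := ubnP #|A|; elim: n A phi => // n IH A phi.
have [->|[x xA]] := finset.set_0Vmem A => [_|An].
  rewrite !finset.set0I !cards0 /= (bigD1 finset.set0) //= big1; last first.
    by move=> S S0; rewrite /random_subset finset.subset0 (negbTE S0) mul0r.
  by rewrite /random_subset finset.sub0set big_set0 mul1r !finset.set0I !cards0 addr0.
have xA' : x \notin A :\ x by rewrite !inE eqxx.
have An' : (#|A :\ x| < n)%N by move: An; rewrite (cardsD1 x A) xA.
rewrite -(finset.setD1K xA) random_subset_mean_setU1 //.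
rewrite [X in _ + (1 - q) * X](IH _ _ An').
have cardI (S M : {set V}) : x \notin S ->
    #|(x |: S) :&: M| = ((x \in M) + #|S :&: M|)%N.
  move=> xS; rewrite finset.setIUl; case: (boolP (x \in M)) => xM.
    by rewrite (finset.setIidPl _) ?finset.sub1set // cardsU1 !inE (negbTE xS).
  rewrite (_ : [set x] :&: M = finset.set0) ?finset.set0U //.
  by apply/finset.setP => y; rewrite !inE; case: eqP => // ->; rewrite (negbTE xM).
rewrite !cardI //.
have -> : \sum_S random_subset (A :\ x) q S * phi #|(x |: S) :&: K| #|(x |: S) :&: L|
  = \sum_S random_subset (A :\ x) q S *
      phi ((x \in K) + #|S :&: K|)%N ((x \in L) + #|S :&: L|)%N.
  apply: eq_bigr => S _; case: (boolP (x \in S)) => xS; last by rewrite !cardI.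
  suff -> : random_subset (A :\ x) q S = 0 by rewrite !mul0r.
  rewrite /random_subset ifF //; apply/negbTE/subsetPn.
  by exists x.
rewrite (IH _ (fun i j => phi ((x \in K) + i)%N ((x \in L) + j)%N) An').
case: (boolP (x \in K)) => xK; case: (boolP (x \in L)) => xL.
- by have := disjointFr dKL xK; rewrite xL.
- by [].
- rewrite /= add0n.
  rewrite (binomial_meanD R q _ (fun i => q * binomial_mean q _ (fun j => phi i j.+1))).
  by rewrite !binomial_meanZ.
- by rewrite /= !add0n; ring.
Qed.


(** * Lower bounds on the upper binomial tail *)

(** By inversion, from [expR (2 * q) >= 1 + 2 * q] and [(1 + 2 * q) * (1 - q) >= 1] for [q] up to
    one half. *)
Lemma expRN2_le (R : realType) (q : R) : 0 <= q -> q <= 2^-1 -> expR (- (2 * q)) <= 1 - q.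
Proof.
move=> q0 q2; rewrite expRN invf_ple ?posrE ?expR_gt0 //; last by lra.
apply: le_trans (expR_ge1Dx (2 * q)).
rewrite -[_^-1]mul1r ler_pdivrMr; last by lra.
nra.
Qed.

(* Only binomial means at most about [ln n] occur here, so that a single atom of
   the distribution, estimated by [(k / j) ^ j q ^ j (1 - q) ^ (k - j)], suffices. *)
Lemma binomial_tail_small (R : realType) (n s t q : R) (k j : nat) :
  1 < n -> 0 < s -> s ^+ 2 * ln n = n -> 1 <= t ->
  2 * s * t / n <= q -> q <= 2^-1 -> q * s < 1 ->
  s * t <= k%:R -> k%:R <= s * t + 1 -> (0 < j)%N -> (j <= k)%N -> j%:R <= t + 1 ->
  n ^- 2 <= binomial_mean q k (fun i => (i == j)%:R).
Proof.
move=> n1 s0 sL t1 qn q2 qs kt kt1 j0 jk jt.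
have n0 : 0 < n by lra.
have L0 : 0 < ln n by rewrite ln_gt0.
have t0 : 0 < t by lra.
have nE : n^-1 = (s ^+ 2 * ln n)^-1 by rewrite sL.
have jR : 1 <= j%:R :> R by rewrite ler1n.
have q0 : 0 <= q.
  by apply: le_trans qn; rewrite !mulr_ge0 ?invr_ge0 // ltW.
(* Since [n = s ^+ 2 * ln n], this follows from [2 * s * t / n <= q] and [q * s < 1]. *)
have tL : 2 * t <= ln n.
  have : 2 * s * t / n * s < 1 by apply: le_lt_trans qs; rewrite ler_pM2r.
  rewrite (_ : 2 * s * t / n * s = 2 * t / ln n); last first.
    by rewrite nE; field; rewrite !gt_eqF.
  by rewrite ltr_pdivrMr // mul1r => /ltW.
(* Here [k >= s * t] and [j <= t + 1 <= 2 * t] give [k / j >= s / 2]. *)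
have base : t / ln n <= k%:R / j%:R * q.
  have -> : t / ln n = (s * t) / (2 * t) * (2 * s * t / n).
    by rewrite nE; field; rewrite !gt_eqF.
  rewrite ler_pM //.
  - by rewrite divr_ge0 // ?mulr_ge0 // ltW.
  - by rewrite divr_ge0 // ?mulr_ge0 // ltW.
  - rewrite ler_pM // ?mulr_ge0 ?invr_ge0 ?mulr_ge0 ?(ltW s0) ?(ltW t0) //.
    by rewrite lef_pV2 ?posrE ?mulr_gt0 //; lra.
have baseE : expR (- (ln n / t - 1)) <= t / ln n.
  have -> : t / ln n = (ln n / t)^-1 by rewrite invf_div.
  rewrite expRN lef_pV2 ?posrE ?expR_gt0 ?divr_gt0 //.
  by apply: le_trans (expR_ge1Dx _); lra.
have Lt1 : 0 <= ln n / t - 1.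
  by rewrite subr_ge0 ler_pdivlMr // mul1r; lra.
(* The exponent [j] is at most [2 * t], and [2 * t * (ln n / t - 1) = 2 * ln n - 2 * t]. *)
have powj : expR (- (2 * ln n - 2 * t)) <= (k%:R / j%:R * q) ^+ j.
  apply: (@le_trans _ _ (expR (- (ln n / t - 1)) ^+ j)); last first.
    by rewrite lerXn2r ?nnegrE ?expR_ge0 ?(le_trans baseE base) //
       ?mulr_ge0 ?divr_ge0.
  rewrite -expRM_natl ler_expR.
  have -> : - (2 * ln n - 2 * t) = - ((2 * t) * (ln n / t - 1)).
    by field; rewrite gt_eqF.
  by rewrite mulrN lerN2 ler_wpM2r //; lra.
(* At most [s * t] trials fail, and [q * s < 1] bounds the total exponent by [2 * t]. The two
   exponents then add up to [2 * ln n]. *)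
have powkj : expR (- (2 * t)) <= (1 - q) ^+ (k - j).
  apply: (@le_trans _ _ (expR (- (2 * q)) ^+ (k - j))); last first.
    by rewrite lerXn2r ?nnegrE ?expR_ge0 ?expRN2_le //; lra.
  rewrite -expRM_natl ler_expR mulrN lerN2.
  have kjR : (k - j)%:R <= s * t by rewrite natrB //; lra.
  have : (k - j)%:R * (2 * q) <= s * t * (2 * q) by rewrite ler_wpM2r //; lra.
  move/le_trans; apply.
  have -> : s * t * (2 * q) = (q * s) * (2 * t) by ring.
  by rewrite -[leRHS]mul1r ler_wpM2r //; lra.
rewrite binomial_mean_eq.
have -> : n ^- 2 = expR (- (2 * ln n - 2 * t)) * expR (- (2 * t)).
  rewrite -expRD (_ : _ + _ = - (2%:R * ln n)); last by ring.
  by rewrite expRN expRM_natl lnK ?posrE.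
rewrite ler_pM ?expR_ge0 //; apply: le_trans powj _.
by rewrite exprMn ler_wpM2r ?exprn_ge0 // bin_ge_expr_div.
Qed.

Lemma binomial_tail (R : realType) (n s W q : R) (k : nat) :
  2 <= n -> 1 <= s -> s ^+ 2 * ln n = n -> 1 <= W ->
  W / n <= q -> q <= 2^-1 -> W / 2 < k%:R ->
  (4 * n ^+ 2)^-1 <= binomial_mean q k (fun i => (W / (2 * s) <= i%:R)%R%:R).
Proof.
move=> n2 s1 sL W1 Wq q2 Wk.
have [n0 s0] : 0 < n /\ 0 < s by split; lra.
have qn : n^-1 <= q.
  by apply: le_trans Wq; rewrite -[leLHS]mul1r ler_wpM2r // invr_ge0 ltW.
have nV0 : 0 < n^-1 by rewrite invr_gt0.
have [q0 q1] : 0 <= q /\ q <= 1 by split; lra.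
pose t : R := W / (2 * s).
have tE : s * t = W / 2 by rewrite /t; field; rewrite gt_eqF.
have t0 : 0 < t by rewrite divr_gt0 ?mulr_gt0 //; lra.
set phi := fun i : nat => (W / (2 * s) <= i%:R)%R%:R : R.
have phiS i : phi i <= phi i.+1.
  rewrite /phi ler_nat; case: leP => // /le_trans; rewrite -/t => ti.
  by rewrite ti // ler_nat.
have n4 : (4 * n ^+ 2)^-1 <= n^-1.
  by rewrite lef_pV2 ?posrE ?mulr_gt0 ?exprn_gt0 //; nra.
have W20 : 0 <= W / 2 by lra.
have /andP[k0l k0u] := truncn_itv W20.
(* The least number of trials exceeding [W / 2]; unlike [k], it is also bounded above, by
   [W / 2 + 1]. *)
pose k0 := (Num.trunc (W / 2)).+1.
have k0k : (k0 <= k)%N by rewrite /k0 -(ltr_nat R); apply: le_lt_trans k0l Wk.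
have k0W : k0%:R <= W / 2 + 1 by rewrite /k0 -natr1; lra.
apply: (@le_trans _ _ (binomial_mean q k0 phi)); last exact: binomial_mean_homo.
(* If the threshold is at most 1, a single successful trial reaches it, with probability
   [q >= n^-1]. *)
have [t1|t1] := leP t 1.
  apply: (@le_trans _ _ (binomial_mean q 1 phi)); last exact: binomial_mean_homo.
  apply: le_trans n4 _; apply: le_trans qn _.
  rewrite /= {1}/phi -/t t1 mulr1n mulr1 lerDl mulr_ge0 ?subr_ge0 //.
have [qs|qs] := ltP (q * s) 1.
  have /andP[jl ju] := truncn_itv (ltW t0).
  (* The first integer above the threshold; it is at most [k0] because [t <= s * t = W / 2]. *)
  pose j := (Num.trunc t).+1.
  apply: (@le_trans _ _ (n ^- 2)).
    rewrite lef_pV2 ?posrE ?mulr_gt0 ?exprn_gt0 //.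
    by have := exprn_ge0 2 (ltW n0); lra.
  apply: (@le_trans _ _ (binomial_mean q k0 (fun i => (i == j)%:R))).
    apply: (@binomial_tail_small _ n s t) => //.
    - by lra.
    - exact: ltW.
    - have -> : 2 * s * t = W by rewrite -mulrA tE; lra.
      by [].
    - by rewrite tE ltW.
    - by rewrite tE.
    - rewrite /j /k0 ltnS; apply: le_truncn.
      by rewrite -tE ler_peMl // ltW.
    - by rewrite /j -natr1; lra.
  apply: binomial_mean_le => // i _; rewrite ler_nat /phi -/t.
  by case: eqP => // ->; rewrite /j (ltW ju).
have k0n : k0%:R <= n.
  have : W <= q * n by rewrite -ler_pdivrMr.
  have : q * n <= n / 2 by rewrite mulrC ler_wpM2l // ltW.
  by lra.
(* Now [1 <= q * s], so [t = W / 2 / s] is at most the mean [k0 * q]. The variance bound is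
   estimated by [q >= n^-1], [1 - q >= 2^-1] and [k0 <= n]. *)
apply: (@le_trans _ _ (q * (1 - q) / (2 * k0%:R))).
  have -> : (4 * n ^+ 2)^-1 = n^-1 * 2^-1 / (2 * n) by field; rewrite gt_eqF.
  rewrite ler_pM ?mulr_ge0 ?invr_ge0 ?mulr_ge0 ?(ltW n0) //.
    by rewrite ler_pM ?invr_ge0 ?(ltW n0) //; lra.
  by rewrite lef_pV2 ?posrE ?mulr_gt0 ?ler_pM2l.
apply: le_trans (binomial_tail_ge_mean _ _ _ _ q0 q1) _ => //.
apply: binomial_mean_le => // i _; rewrite ler_nat /phi -/t.
case: leP => // /(le_trans _) -> //.
have -> : t = (W / 2) / s by rewrite -tE; field; rewrite gt_eqF.
rewrite ler_pdivrMr // -mulrA; apply: le_trans (ltW k0u) _.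
by rewrite ler_peMr.
Qed.


(** * Weights and submodular functions *)

Lemma weightE (R : realType) (V : finType) (w : V -> bool) (S : {set V}) :
  weight R w S = #|S :&: [set v | w v]|%:R.
Proof.
rewrite /weight -sum1_card natr_sum big_mkcond [RHS]big_mkcond /=.
by apply: eq_bigr => v _; rewrite !inE; case: (v \in S); case: (w v).
Qed.

Lemma weight_ge0 (R : realType) (V : finType) (w : V -> bool) (S : {set V}) :
  0 <= weight R w S.
Proof. by rewrite weightE. Qed.

Lemma weightS (R : realType) (V : finType) (w : V -> bool) (S T : {set V}) :
  S \subset T -> weight R w S <= weight R w T.
Proof. by move=> sST; rewrite !weightE ler_nat subset_leq_card ?finset.setSI. Qed.

Lemma weightUI (R : realType) (V : finType) (w : V -> bool) (S T : {set V}) :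
  weight R w (S :|: T) + weight R w (S :&: T) = weight R w S + weight R w T.
Proof.
rewrite !weightE -!natrD -[in RHS]cardsUI -finset.setIUl finset.setIACA.
by rewrite finset.setIid.
Qed.

Lemma weightID (R : realType) (V : finType) (w : V -> bool) (S T : {set V}) :
  weight R w S = weight R w (S :&: T) + weight R w (S :\: T).
Proof.
rewrite -weightUI finset.setID finset.setDE finset.setIACA finset.setICr.
by rewrite finset.setI0 [X in _ + X]weightE finset.set0I cards0 addr0.
Qed.

Lemma weight_setU_ge (R : realType) (V : finType) (w : V -> bool)
    (U S T : {set V}) : S \subset ~: U ->
  weight R w U + weight R w (T :&: S) <= weight R w (U :|: T).
Proof.
move=> sSU; rewrite -weightUI.
have -> : weight R w (U :&: (T :&: S)) = 0.
  rewrite weightE (_ : _ :&: _ = finset.set0) ?cards0 //.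
  apply/finset.setP => x; rewrite !inE; apply/negP => /andP[/and3P[xU _ xS] _].
  by have := fintype.subsetP sSU x xS; rewrite !inE xU.
by rewrite addr0; apply: weightS; apply: finset.setUS; apply: finset.subsetIl.
Qed.

Lemma submodular_sub_weight (R : realType) (V : finType) (f : {set V} -> R)
    (w : V -> bool) (a : R) (S : {set V}) : submodular f ->
  submodular (fun T => f T - a * weight R w (T :&: S)).
Proof.
move=> fs X Y; have := fs X Y.
have := weightUI R V w (X :&: S) (Y :&: S).
rewrite -finset.setIUl finset.setIACA finset.setIid => /(congr1 ( *%R a)).
rewrite !mulrDr; lra.
Qed.

Lemma submodular_subadditive (R : realType) (V : finType) (f : {set V} -> R)
    (S T : {set V}) : (forall S, 0 <= f S) -> submodular f ->
  f (S :|: T) <= f S + f T.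
Proof. by move=> f0 /(_ S T); have := f0 (S :&: T); lra. Qed.

(** * Probabilities of programs and the random-sampling loop *)

Lemma prob_dret (R : realType) (T : finType) (x : T) (E : pred T) :
  prob (dret R x) E = (E x)%:R.
Proof.
rewrite /prob big_mkcond (bigD1 x) //= big1 ?addr0 /dret ?eqxx.
  by case: (E x).
by move=> y /negbTE ->; case: ifP.
Qed.

Lemma prob_dbind (R : realType) (T T' : finType) (d : dist R T)
    (k : T -> dist R T') (E : pred T') :
  prob (dbind d k) E = \sum_x d x * prob (k x) E.
Proof.
rewrite /prob /dbind exchange_big /=; apply: eq_bigr => x _.
by rewrite mulr_sumr.
Qed.

Lemma prob_ge0 (R : realType) (T : finType) (d : dist R T) (E : pred T) :
  (forall x, 0 <= d x) -> 0 <= prob d E.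
Proof. by move=> d0; apply: sumr_ge0 => x _. Qed.

Lemma small_loop_ge0 (R : realType) (V : finType) (sfm : sfm_oracle R V)
    (f : {set V} -> R) (w : V -> bool) (W B p : R) (fuel k : nat)
    (h : seq ({set V} -> R)) (U : {set V}) (o : option {set V}) :
  0 <= W / weight R w [set: V] -> W / weight R w [set: V] <= 1 ->
  0 <= small_loop sfm f w W B p fuel k h U o.
Proof.
move=> q0 q1; elim: fuel k h U => [|fuel IH] k h U /=; first exact: ler0n.
case: ifP => _; last exact: ler0n.
apply: sumr_ge0 => S _; rewrite mulr_ge0 ?random_subset_ge0 //.
by case: ifP => _; [apply: ler0n | apply: IH].
Qed.

(* The bound [4 * B * s] on the last set added is only available because all the
   earlier ones are charged to the weight they gained, at most [W / 2] in total.
   The empty set is apart since [f set0] is arbitrary. *)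
Definition charged (R : realType) (V : finType) (f : {set V} -> R)
    (w : V -> bool) (W B s : R) (U : {set V}) : Prop :=
  U = finset.set0 \/
  f U <= 2 * B / W * s * weight R w U /\ f U <= 5 * s * B.

Lemma charged_step (R : realType) (V : finType) (f : {set V} -> R)
    (w : V -> bool) (W B s : R) (U S T : {set V}) :
  (forall S, 0 <= f S) -> submodular f -> 0 < W -> 0 < B -> 0 < s ->
  S \subset ~: U -> weight R w U < W / 2 ->
  f T <= 2 * B / W * s * weight R w (T :&: S) -> f T <= 4 * B * s ->
  charged R V f w W B s U -> charged R V f w W B s (U :|: T).
Proof.
move=> f0 fs W0 B0 s0 sSU wU fT1 fT2 cU; right.
have a0 : 0 < 2 * B / W * s by rewrite !mulr_gt0 ?invr_gt0.
have Bs : 0 < B * s by rewrite mulr_gt0.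
have wUT : weight R w U + weight R w (T :&: S) <= weight R w (U :|: T).
  exact: weight_setU_ge.
case: cU => [U0|[fU1 fU2]].
  rewrite U0 finset.set0U; split; last by lra.
  by apply: le_trans fT1 _; rewrite ler_pM2l //; apply/weightS/finset.subsetIl.
have fUT : f (U :|: T) <= f U + f T by exact: submodular_subadditive.
split.
  apply: le_trans fUT _; apply: le_trans (lerD fU1 fT1) _.
  by rewrite -mulrDr ler_pM2l.
have : 2 * B / W * s * weight R w U <= 2 * B / W * s * (W / 2).
  by rewrite ler_pM2l // ltW.
rewrite (_ : 2 * B / W * s * (W / 2) = B * s); first by lra.
by field; rewrite gt_eqF.
Qed.

Definition good_sample (R : realType) (V : finType) (w : V -> bool) (W s : R)
    (Ustar : {set V}) : pred {set V} :=
  fun S => (W / (2 * s) <= weight R w (S :&: Ustar)) &&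
           (weight R w (S :\: Ustar) <= 3 / 2 * W).

(** The first condition makes the objective negative at [Ustar], hence at the minimizer [T]: its
    price covers its cost, and its gain is a positive integer. By the second, [T] collects at most
    [3 / 2 * W] more than [Ustar], so minimality gives [f T <= B + 3 * B * s <= 4 * B * s]. *)
Lemma good_sample_step (R : realType) (V : finType) (f : {set V} -> R)
    (w : V -> bool) (W B s : R) (Ustar S T : {set V}) :
  0 < W -> 0 < B -> 1 <= s -> 0 <= f T -> f Ustar < B ->
  f T - 2 * B / W * s * weight R w (T :&: S) <=
    f Ustar - 2 * B / W * s * weight R w (Ustar :&: S) ->
  good_sample R V w W s Ustar S ->
  [/\ f T <= 2 * B / W * s * weight R w (T :&: S), f T <= 4 * B * s &
      1 <= weight R w (T :&: S)].
Proof.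
move=> W0 B0 s1 fT0 fU minT /andP[good1 good2].
have s0 : 0 < s by lra.
have a0 : 0 < 2 * B / W * s by rewrite !mulr_gt0 ?invr_gt0.
have aB : B <= 2 * B / W * s * weight R w (Ustar :&: S).
  rewrite finset.setIC -[leLHS](_ : 2 * B / W * s * (W / (2 * s)) = B).
    by rewrite ler_pM2l.
  by field; rewrite !gt_eqF.
have lt1 : f T < 2 * B / W * s * weight R w (T :&: S) by lra.
have lt2 : 2 * B / W * s * weight R w (T :&: S) <=
    2 * B / W * s * weight R w (Ustar :&: S) + 3 * B * s.
  rewrite -(_ : 2 * B / W * s * (3 / 2 * W) = 3 * B * s); last first.
    by field; rewrite gt_eqF.
  rewrite -mulrDr ler_pM2l // (_ : Ustar :&: S = S :&: Ustar) 1?finset.setIC //.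
  apply: (@le_trans _ _ (weight R w S)); first exact/weightS/finset.subsetIl.
  by rewrite (weightID R V w S Ustar) lerD2l.
split; first exact: ltW.
  have : B <= B * s by rewrite ler_peMr // ltW.
  lra.
have : 0 < 2 * B / W * s * weight R w (T :&: S) by apply: le_lt_trans lt1.
by rewrite pmulr_rgt0 // weightE ltr0n ler1n.
Qed.

(* Each iteration gains weight with probability at least [rho], whatever the
   past: with [d] units missing and [r] iterations left, the failure probability
   is at most the mean of [2 ^ (units still missing)], which shrinks by the
   factor [1 - rho / 2] at every iteration. *)
Lemma small_loop_success (R : realType) (V : finType) (f : {set V} -> R)
    (w : V -> bool) (W B p rho : R) (sfm : sfm_oracle R V) (Ustar : {set V})
    (K r k fuel d : nat) (h : seq ({set V} -> R)) (U : {set V}) :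
  let s := sqrt_n_over_ln R V in
  let q := W / weight R w [set: V] in
  (forall S, 0 <= f S) -> submodular f -> exact_sfm sfm ->
  0 < W -> 0 < B -> 1 <= s -> f Ustar < B -> 0 <= q -> q <= 1 ->
  0 <= rho -> rho <= 1 ->
  (forall U, weight R w U < W / 2 ->
     rho <= prob (random_subset (~: U) q) (good_sample R V w W s Ustar)) ->
  K%:R <= iteration_bound V p -> (k + r = K)%N -> (r < fuel)%N ->
  charged R V f w W B s U -> W / 2 <= weight R w U + d%:R ->
  1 - 2 ^+ d * (1 - rho / 2) ^+ r <=
  prob (small_loop sfm f w W B p fuel k h U)
       (bicriteria_solution f w W B (5 * s) (1 / 2)).
Proof.
move=> s q f0 fs sfmE W0 B0 s1 fU q0 q1 rho0 rho1 rhoP KB.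
have s0 : 0 < s by lra.
have rh0 : 0 <= 1 - rho / 2 by lra.
have fail0 (e l : nat) : 0 <= 2 ^+ e * (1 - rho / 2) ^+ l.
  by rewrite mulr_ge0 // exprn_ge0.
elim: r k fuel d h U => [|r IH] k [|fuel] d h U //= kr rf cU Wd.
all: case: ifPn => [wU|]; last first.
1,3: rewrite -leNgt => wU; rewrite prob_dret /=.
1,2: suff -> : (f U <= 5 * s * B) && (1 / 2 * W <= weight R w U);
  first by rewrite mulr1n lerBlDr lerDl.
1,2: case: cU wU => [->|[_ ->]];
  [rewrite weightE finset.set0I cards0; lra | by move=> wU /=; lra].
all: have d0 : (0 < d)%N by case: d Wd => // Wd; rewrite addr0 in Wd; lra.
  (* With [r = 0] and [0 < d] the claimed bound [1 - 2 ^+ d] is at most 0. *)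
  apply: (@le_trans _ _ 0).
    by rewrite expr0 mulr1 subr_le0 exprn_ege1 // ler1n.
  rewrite prob_dbind sumr_ge0 // => S _.
  rewrite mulr_ge0 ?random_subset_ge0 // prob_ge0 // => o.
  by case: ifP => _; [apply: ler0n | apply: small_loop_ge0].
have kK : (iteration_bound V p < k.+1%:R) = false.
  apply/negbTE; rewrite -leNgt; apply: le_trans KB.
  by rewrite ler_nat -kr -addSnnS leq_addr.
rewrite prob_dbind.
pose c : R := 2 ^+ d * (1 - rho / 2) ^+ r.
have c0 : 0 <= c by exact: fail0.
pose good := good_sample R V w W s Ustar.
(* A bad sample leaves [d] unchanged and guarantees [1 - c]; a good one lowers [d] by one, halving
   the failure bound to [c / 2]. *)
apply: (@le_trans _ _ (\sum_S random_subset (~: U) q S *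
    (1 - c + c / 2 * (good S)%:R))).
  have -> : \sum_S random_subset (~: U) q S * (1 - c + c / 2 * (good S)%:R) =
      1 - c + c / 2 * prob (random_subset (~: U) q) good.
    transitivity (\sum_S random_subset (~: U) q S * (1 - c) +
                  \sum_S c / 2 * (random_subset (~: U) q S * (good S)%:R)).
      by rewrite -big_split; apply: eq_bigr => S _ /=; ring.
    rewrite -mulr_suml random_subset_sum1 mul1r -mulr_sumr /prob.
    congr (_ + _ * _); rewrite [RHS]big_mkcond; apply: eq_bigr => S _.
    by case: (good S); rewrite ?mulr1 ?mulr0.
  have := rhoP U wU; rewrite -/good => rhoU.
  rewrite exprSr mulrA -/c.
  have : c / 2 * rho <= c / 2 * prob (random_subset (~: U) q) good.
    by rewrite ler_wpM2l // divr_ge0.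
  lra.
apply: ler_sum => S _.
have [sSU|sSU] := boolP (S \subset ~: U); last first.
  by rewrite /random_subset (negbTE sSU) !mul0r.
apply: ler_wpM2l; first exact: random_subset_ge0.
rewrite kK.
set g := fun T => f T - _; set T := sfm h g.
have minT : g T <= g Ustar by apply: sfmE; apply: submodular_sub_weight.
have kr' : (k.+1 + r = K)%N by rewrite -kr addSnnS.
have cU' : charged R V f w W B s
    (if (f T <= 2 * B / W * s * weight R w (T :&: S)) && (f T <= 4 * B * s)
     then U :|: T else U).
  case: ifP => // /andP[fT1 fT2].
  exact: (charged_step R V f w W B s U S T).
have wU' : forall b : bool, weight R w U <= weight R w (if b then U :|: T else U).
  by case=> //; apply/weightS/finset.subsetUl.
have [goodS|badS] := boolP (good S); last first.
  rewrite mulr0 addr0; apply: IH => //.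
  by apply: le_trans Wd _; rewrite lerD2r.
have [fT1 fT2 wT] := good_sample_step R V f w W B s Ustar S T W0 B0 s1 (f0 T) fU minT goodS.
case: d d0 Wd @c c0 {fail0} => // d _ Wd c c0.
rewrite mulr1 (_ : 1 - c + c / 2 = 1 - 2 ^+ d * (1 - rho / 2) ^+ r); last first.
  by rewrite /c exprS; field.
apply: IH => //; rewrite fT1 fT2 /=.
have := weight_setU_ge R V w U S T sSU.
by rewrite -[d.+1%:R]natr1 in Wd; lra.
Qed.

(** * The deterministic loop *)

(** While [weight R w U < W / 2], more than [W / 2] of [Ustar] lies outside [U], so the objective is
    negative at [Ustar] and the loop cannot fail. The strict test forces a gain of at least 1 per
    iteration, so the fuel outlasts the remaining weight. *)
Lemma large_loop_success (R : realType) (V : finType) (f : {set V} -> R)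
    (w : V -> bool) (W B : R) (sfm : sfm_oracle R V) (Ustar : {set V})
    (fuel : nat) (h : seq ({set V} -> R)) (U : {set V}) :
  (forall S, 0 <= f S) -> submodular f -> exact_sfm sfm ->
  0 < W -> 0 < B -> f Ustar < B -> W <= weight R w Ustar ->
  weight R w [set: V] < weight R w U + fuel%:R ->
  U = finset.set0 \/ f U <= 2 * B / W * weight R w U ->
  exists U', [/\ large_loop sfm f w W B fuel h U = Some U',
    W / 2 <= weight R w U' & f U' <= 2 * B / W * weight R w U'].
Proof.
move=> f0 fs sfmE W0 B0 fU WU.
have a0 : 0 < 2 * B / W by rewrite !mulr_gt0 ?invr_gt0.
elim: fuel h U => [|fuel IH] h U fuelP cU.
  move: fuelP; rewrite addr0 ltNge => /negP; case.
  exact/weightS/finset.subsetT.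
rewrite /=; case: ifPn => [wU|]; last first.
  rewrite -leNgt => wU; exists U; split=> //; case: cU => // U0.
  by move: wU; rewrite U0 weightE finset.set0I cards0; lra.
set g := fun T => f T - _; set T := sfm h g.
have sD (X : {set V}) : X :\: U = X :&: ~: U by rewrite finset.setDE.
have minT : g T <= g Ustar.
  apply: sfmE => X Y.
  by have := submodular_sub_weight R V f w (2 * B / W) (~: U) fs X Y; rewrite -!sD.
have wUU : W / 2 < weight R w (Ustar :\: U).
  have := weightID R V w Ustar U.
  have := weightS R V w (Ustar :&: U) U (finset.subsetIr _ _).
  by lra.
have BW : B < 2 * B / W * weight R w (Ustar :\: U).
  rewrite -[ltLHS](_ : 2 * B / W * (W / 2) = B) ?ltr_pM2l //.
  by field; rewrite gt_eqF.
have fT : f T < 2 * B / W * weight R w (T :\: U) by move: minT; rewrite /g; lra.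
have wT : 1 <= weight R w (T :\: U).
  have : 0 < 2 * B / W * weight R w (T :\: U) by apply: le_lt_trans fT.
  by rewrite pmulr_rgt0 // weightE ltr0n ler1n.
have wUT : weight R w U + weight R w (T :\: U) <= weight R w (U :|: T).
  by rewrite sD; apply: weight_setU_ge.
rewrite fT; apply: IH; first by move: fuelP; rewrite -natr1; lra.
right; apply: (@le_trans _ _ (2 * B / W * (weight R w U + weight R w (T :\: U)))).
  rewrite mulrDr; case: cU => [U0|fU'].
    have : 0 <= 2 * B / W * weight R w U by rewrite mulr_ge0 ?weight_ge0 // ltW.
    by rewrite {2}U0 finset.set0U; lra.
  by apply: le_trans (submodular_subadditive _ _ _ _ _ f0 fs) _; lra.
by rewrite ler_pM2l.
Qed.


(** * Probability of a good sample and the number of iterations *)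

Lemma sqrt_n_over_ln_sqr (R : realType) (V : finType) : (2 <= #|V|)%N ->
  sqrt_n_over_ln R V ^+ 2 * ln #|V|%:R = #|V|%:R.
Proof.
move=> n2; have L0 : 0 < ln #|V|%:R :> R by rewrite ln_gt0 ?ltr1n.
by rewrite sqr_sqrtr ?divr_ge0 ?(ltW L0) // divfK ?gt_eqF.
Qed.

Lemma sqrt_n_over_ln_ge1 (R : realType) (V : finType) : (2 <= #|V|)%N ->
  1 <= sqrt_n_over_ln R V.
Proof.
move=> n2; have L0 : 0 < ln #|V|%:R :> R by rewrite ln_gt0 ?ltr1n.
rewrite -[leLHS]sqrtr1 ler_wsqrtr // ler_pdivlMr // mul1r ltW //.
by rewrite ln_sublinear // ltr0n (leq_trans _ n2).
Qed.

Lemma weight_le_card (R : realType) (V : finType) (w : V -> bool) (S : {set V}) :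
  weight R w S <= #|V|%:R.
Proof. by rewrite weightE ler_nat max_card. Qed.

(** The counts of positive-weight elements inside and outside [Ustar] are independent. The first has
    more than [W / 2] trials, since [U] covers less than [W / 2] of [Ustar]; the second has mean at
    most [m * q = W]. *)
Lemma prob_good_sample (R : realType) (V : finType) (w : V -> bool) (W s : R)
    (Ustar U : {set V}) :
  let n : R := #|V|%:R in
  2 <= n -> 1 <= s -> s ^+ 2 * ln n = n -> 1 <= W ->
  W < weight R w [set: V] / 2 -> W <= weight R w Ustar ->
  weight R w U < W / 2 ->
  (12 * n ^+ 2)^-1 <=
  prob (random_subset (~: U) (W / weight R w [set: V]))
       (good_sample R V w W s Ustar).
Proof.
move=> n n2 s1 sL W1 Wm WU wU; set m := weight R w [set: V] in Wm *.
set q := W / m.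
have m0 : 0 < m by lra.
have mn : m <= n by exact: weight_le_card.
have q0 : 0 <= q by rewrite divr_ge0 ?weight_ge0 //; lra.
have q2 : q <= 2^-1 by rewrite ler_pdivrMr //; lra.
have q1 : q <= 1 by lra.
have nq : W / n <= q by rewrite ler_wpM2l ?lef_pV2 ?posrE //; lra.
pose K := Ustar :&: [set v | w v]; pose L := [set v | w v] :\: Ustar.
have dKL : [disjoint K & L].
  rewrite finset.disjoints_subset; apply/fintype.subsetP => v.
  by rewrite !inE => /andP[-> _].
have wK (S : {set V}) : weight R w (S :&: Ustar) = #|S :&: K|%:R.
  by rewrite weightE -finset.setIA.
have wL (S : {set V}) : weight R w (S :\: Ustar) = #|S :&: L|%:R.
  by rewrite weightE finset.setIDAC finset.setIDA.
pose phi i := ((W / (2 * s) <= i%:R)%R%:R : R).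
pose psi j := ((j%:R <= 3 / 2 * W)%R%:R : R).
have -> : prob (random_subset (~: U) q) (good_sample R V w W s Ustar) =
    binomial_mean q #|~: U :&: K| phi * binomial_mean q #|~: U :&: L| psi.
  transitivity (\sum_S random_subset (~: U) q S * (phi #|S :&: K| * psi #|S :&: L|)).
    rewrite /prob big_mkcond; apply: eq_bigr => S _.
    rewrite /good_sample wK wL /phi /psi.
    by case: (_ <= _); case: (_ <= _); rewrite ?mulr0n ?mulr1n ?mul0r ?mulr0 ?mulr1.
  rewrite (random_subset_mean_card _ _ _ _ _ _ (fun i j => phi i * psi j)) //.
  rewrite mulrC -binomial_meanZ; congr binomial_mean; apply/funext => i.
  by rewrite binomial_meanZ mulrC.
have -> : (12 * n ^+ 2)^-1 = (4 * n ^+ 2)^-1 * 3^-1 by field; rewrite gt_eqF //; lra.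
rewrite ler_pM // ?invr_ge0 ?mulr_ge0 ?exprn_ge0 //.
  apply: (binomial_tail R n) => //; rewrite -wK finset.setIC -finset.setDE.
  have := weightID R V w Ustar U.
  have := weightS R V w (Ustar :&: U) U (finset.subsetIr _ _).
  by lra.
apply: le_trans (binomial_markov R q (3 / 2 * W) _ q0 q1 _); last by lra.
have lm : #|~: U :&: L|%:R <= m :> R.
  by rewrite -wL; apply: weightS; apply: finset.subsetT.
have : #|~: U :&: L|%:R * q / (3 / 2 * W) <= 2 / 3; last by lra.
rewrite ler_pdivrMr; last by lra.
have : #|~: U :&: L|%:R * q <= m * q by rewrite ler_wpM2r.
rewrite (_ : m * q = W); first by lra.
by rewrite /q mulrC divfK // gt_eqF.
Qed.

(** The factor 24 is [3 * 8], from [1 / c = 4 * Num.sqrt (2 * pi) >= 8]; the exponent [9 / 2] is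
    lowered to 4. *)
Lemma iteration_bound_ge (R : realType) (V : finType) (p : R) :
  (2 <= #|V|)%N -> 0 < p -> p < 1 ->
  24 * #|V|%:R ^+ 4 * ln (#|V|%:R / (1 - p)) <= iteration_bound V p.
Proof.
move=> n2 p0 p1; rewrite /iteration_bound; set n : R := #|V|%:R.
have nR : 2 <= n by rewrite ler_nat.
have L0 : 0 <= ln (n / (1 - p)).
  by rewrite ln_ge0 // ler_pdivlMr; lra.
apply: ler_wpM2r => //.
rewrite div1r invrK.
have -> : 3 * n `^ (9 / 2) * (4 * Num.sqrt (2 * pi)) =
    12 * Num.sqrt (2 * pi) * n `^ (9 / 2) by ring.
rewrite ler_pM // ?exprn_ge0 ?mulr_ge0 //; try lra.
- have : 2 <= Num.sqrt (2 * pi) :> R; last by lra.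
  rewrite -[leLHS]ger0_norm // -sqrtr_sqr ler_wsqrtr //.
  by have := pi_ge2 R; rewrite expr2; lra.
- rewrite -powR_mulrn; last by lra.
  by rewrite ler_powR //; lra.
Qed.

Lemma ln2_ge_half (R : realType) : 2^-1 <= ln 2 :> R.
Proof.
have /(le_ln1Dx (R := R)) : -1 < - 2^-1 :> R by lra.
rewrite (_ : 1 + - 2^-1 = 2^-1); last by lra.
by rewrite lnV ?posrE //; lra.
Qed.

(** With [x] half the gain probability, [(1 - x) ^+ K <= expR (- (x * K))], which is at most
    [((1 - p) / n) ^+ n]; as [2 <= n], the factor [2 ^+ n] is absorbed by the powers of [n]. *)
Lemma iterations_suffice (R : realType) (V : finType) (p : R) (K : nat) :
  (2 <= #|V|)%N -> 0 < p -> p < 1 -> iteration_bound V p < K.+1%:R ->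
  2 ^+ #|V| * (1 - (12 * #|V|%:R ^+ 2)^-1 / 2) ^+ K <= 1 - p.
Proof.
move=> n2 p0 p1; have := iteration_bound_ge R V p n2 p0 p1.
set n := #|V| in n2 *; set L := ln _ => bL bK.
have nR : 2 <= n%:R :> R by rewrite ler_nat.
have n0 : 0 < n%:R :> R by lra.
have nn : n%:R ^+ 2 != 0 :> R by rewrite expf_neq0 // gt_eqF.
have np0 : 0 < n%:R / (1 - p) by rewrite divr_gt0 //; lra.
have LE : expR (- L) = (1 - p) / n%:R.
  by rewrite expRN lnK ?posrE // invf_div.
have L2 : 2^-1 <= L.
  apply: le_trans (ln2_ge_half R) _; rewrite ler_ln ?posrE //.
  rewrite ler_pdivlMr; [nra | lra].
have n3 : 8 <= n%:R ^+ 3 :> R.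
  by rewrite (_ : 8 = 2 ^+ 3 :> R) ?lerXn2r ?nnegrE //; ring.
set x := (12 * _ ^+ 2)^-1 / 2.
have x0 : 0 <= x by rewrite !mulr_ge0 ?invr_ge0 ?mulr_ge0 ?exprn_ge0 ?ltW.
have x1 : x <= 1.
  rewrite ler_pdivrMr // mul1r (@le_trans _ _ 1) ?ler1n // invf_le1; first by nra.
  by rewrite mulr_gt0 ?exprn_gt0.
have xK : n%:R * L <= x * K%:R.
  have -> : x * K%:R = K%:R / (24 * n%:R ^+ 2) by rewrite /x; field; rewrite gt_eqF.
  rewrite ler_pdivlMr; last by rewrite mulr_gt0 ?exprn_gt0.
  have -> : n%:R * L * (24 * n%:R ^+ 2) = 24 * n%:R ^+ 3 * L by ring.
  have bK' : 24 * n%:R ^+ 4 * L < K%:R + 1 by rewrite natr1; apply: le_lt_trans bK.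
  (* The factor 2 gained from [2 <= n], together with [n ^+ 3 * L >= 4], absorbs the 1 lost in
     rounding to [K]. *)
  have : 24 * n%:R ^+ 3 * L * 2 <= 24 * n%:R ^+ 4 * L.
    rewrite [n%:R ^+ 4]exprSr.
    have -> : 24 * (n%:R ^+ 3 * n%:R) * L = 24 * n%:R ^+ 3 * L * n%:R by ring.
    by rewrite ler_wpM2l // !mulr_ge0 //; lra.
  have : 8 * 2^-1 <= n%:R ^+ 3 * L by rewrite ler_pM //; lra.
  by lra.
have : (1 - x) ^+ K <= ((1 - p) / n%:R) ^+ n.
  apply: (@le_trans _ _ (expR (- x) ^+ K)).
    by rewrite lerXn2r ?nnegrE ?expR_ge0 ?expR_ge1Dx //; lra.
  by rewrite -LE -!expRM_natl ler_expR !mulrN lerN2 [leRHS]mulrC.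
move=> Kn; apply: (@le_trans _ _ (2 ^+ n * ((1 - p) / n%:R) ^+ n)).
  by rewrite ler_wpM2l // exprn_ge0.
rewrite -exprMn; apply: (@le_trans _ _ ((1 - p) ^+ n)).
  rewrite lerXn2r ?nnegrE //; try lra.
    by rewrite mulr_ge0 // divr_ge0 //; lra.
  rewrite mulrA ler_pdivrMr //; nra.
rewrite -[leRHS]expr1; apply: ler_wiXn2l; try lra.
exact: leq_trans n2.
Qed.

(** * Assembly of the two cases *)

Theorem theorem14 (R : realType) (V : finType) (f : {set V} -> R)
    (w : V -> bool) (W B p : R) (sfm : sfm_oracle R V)
    (n_ge2 : (2 <= #|V|)%N)
    (f_ge0 : forall S : {set V}, 0 <= f S)
    (f_submod : submodular f)
    (W_gt0 : 0 < W)
    (W_ge1 : W < weight R w [set: V] / 2 -> 1 <= W)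
    (B_gt0 : 0 < B)
    (p_gt0 : 0 < p) (p_lt1 : p < 1)
    (sfm_exact : exact_sfm sfm)
    (instance_feasible : feasible f w W B) :
  exists N : nat, forall fuel : nat, (N <= fuel)%N ->
    p <= prob (procedure sfm f w W B p fuel)
              (bicriteria_solution f w W B (5 * sqrt_n_over_ln R V) (1 / 2)).
Proof.
have [Ustar [WU fU]] := instance_feasible.
have s1 := sqrt_n_over_ln_ge1 R V n_ge2.
have mn := weight_le_card R V w [set: V].
rewrite /procedure; have [Wm|Wm] := leP (weight R w [set: V] / 2) W; last first.
  have W1 := W_ge1 Wm.
  have b0 : 0 <= iteration_bound V p.
    apply: le_trans (iteration_bound_ge R V p n_ge2 p_gt0 p_lt1).
    rewrite !mulr_ge0 ?exprn_ge0 // ln_ge0 // ler_pdivlMr; last by lra.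
    by have : 2 <= #|V|%:R :> R; [rewrite ler_nat | lra].
  have /andP[Kb bK] := truncn_itv b0.
  set K := Num.trunc _ in Kb bK.
  (* All [K] permitted iterations, plus one unit of fuel for the last loop test. The missing weight
     is initially at most [#|V|]. *)
  exists K.+1 => fuel Kfuel.
  have nR : 2 <= #|V|%:R :> R by rewrite ler_nat.
  have n1 : 1 <= 12 * #|V|%:R ^+ 2 :> R by nra.
  have q0 : 0 <= W / weight R w [set: V] by rewrite divr_ge0 ?weight_ge0 // ltW.
  have q1 : W / weight R w [set: V] <= 1 by rewrite ler_pdivrMr; lra.
  have good U : weight R w U < W / 2 -> (12 * #|V|%:R ^+ 2)^-1 <=
      prob (random_subset (~: U) (W / weight R w [set: V]))
           (good_sample R V w W (sqrt_n_over_ln R V) Ustar).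
    by move=> wU; apply: prob_good_sample => //; apply: sqrt_n_over_ln_sqr.
  apply: le_trans (small_loop_success R V f w W B p (12 * #|V|%:R ^+ 2)^-1 sfm
    Ustar K K 0 fuel #|V| [::] finset.set0 f_ge0 f_submod sfm_exact W_gt0 B_gt0
    s1 fU q0 q1 _ _ good Kb _ Kfuel _ _) => //.
  - by rewrite lerBrDr addrC -lerBrDr; apply: iterations_suffice.
  - by rewrite invf_le1 //; lra.
  - by left.
  - by rewrite weightE finset.set0I cards0 add0r; lra.
exists #|V|.+1 => fuel nfuel.
have [||U' [-> wU' fU']] := large_loop_success R V f w W B sfm Ustar fuel [::]
    finset.set0 f_ge0 f_submod sfm_exact W_gt0 B_gt0 fU WU.
- rewrite [weight R w finset.set0]weightE finset.set0I cards0 add0r; apply: le_lt_trans mn _.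
  by rewrite ltr_nat.
- by left.
rewrite prob_dret /= (_ : _ && _) ?mulr1n ?(ltW p_lt1) //.
apply/andP; split; last by lra.
(* In this case the total weight is at most [2 * W], so the charge is at most [4 * B]. *)
have : 2 * B / W * weight R w U' <= 2 * B / W * (2 * W).
  rewrite ler_pM2l; last by rewrite !mulr_gt0 ?invr_gt0.
  by have := weightS R V w U' [set: V] (finset.subsetT _); lra.
rewrite (_ : 2 * B / W * (2 * W) = 4 * B); last by field; rewrite gt_eqF.
have : B <= sqrt_n_over_ln R V * B by rewrite ler_peMl // ltW.
lra.
Qed.
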